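(* Let $\Lambda$ be a finite simplicial graph with vertices $v_1,\dots,v_n$, let $G_i$ be a group attached to $v_i$ for $1\le i\le n$, and let $G$ be the associated graph product. Suppose that each $G_i$ has a finite inverse-closed generating set $X_i$ such that both the geodesic language $\Gamma(G_i,X_i)$ and the geodesic conjugacy language $\widetilde\Gamma(G_i,X_i)$ are regular languages. Then both the geodesic language $\Gamma(G,\bigcup_{i=1}^n X_i)$ and the geodesic conjugacy language $\widetilde\Gamma(G,\bigcup_{i=1}^n X_i)$ are regular languages.
   Context: Graph product: given a finite simplicial graph with a group attached to each vertex, the associated graph product is the group generated by the vertex groups, subject to the relations of the vertex groups together with the relations that elements of distinct adjacent vertex groups commute. For a group $G$ with finite inverse-closed generating set $X$, let $\pi:X^*\to G$ be the natural projection and $l(w)$ the length of a word $w\in X^*$. For $g\in G$, $|g|$ is the length of a shortest word over $X$ representing $g$, and $|g|_c:=\min\{|h| : h \text{ conjugate to } g \text{ in } G\}$. The geodesic language is $\Gamma(G,X):=\{w\in X^* : l(w)=|\pi(w)|\}$. The geodesic conjugacy language is $\widetilde\Gamma(G,X):=\{w\in X^* : l(w)=|\pi(w)|_c\}$. A language is regular if it is the language accepted by a finite state automaton. *)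

(* Defs.v *)
From HB Require Import structures.
From mathcomp Require Import all_boot.
From mathcomp Require Import generic_quotient finmap.
From mathcomp Require Import boolp classical_sets.

Set Implicit Arguments.
Unset Strict Implicit.
Unset Printing Implicit Defensive.

Local Open Scope quotient_scope.
Local Open Scope classical_set_scope.
Local Open Scope group_scope.

Section GraphProduct.

Variables (V : finType) (e : rel V) (G : V -> groupType).

Definition syllable := {v : V & G v}.

Definition syl (v : V) (g : G v) : syllable := Tagged (fun v => G v : Type) g.

Inductive gp_relation : seq syllable -> seq syllable -> Prop :=
| GpOne v : gp_relation [:: syl (1 : G v)] [::]
| GpMul v (g h : G v) : gp_relation [:: syl g; syl h] [:: syl (g * h)]
| GpComm u v (g : G u) (h : G v) :
    e u v -> gp_relation [:: syl g; syl h] [:: syl h; syl g].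

(* The congruence on the free monoid of syllables generated by gp_relation; its
   quotient is already a group, because each vertex group has inverses. *)
Inductive gp_equiv : seq syllable -> seq syllable -> Prop :=
| GpRel p q s t : gp_relation s t -> gp_equiv (p ++ s ++ q) (p ++ t ++ q)
| GpRefl s : gp_equiv s s
| GpSym s t : gp_equiv s t -> gp_equiv t s
| GpTrans s t u : gp_equiv s t -> gp_equiv t u -> gp_equiv s u.

Definition gp_equivb : rel (seq syllable) := fun s t => `[< gp_equiv s t >].

Fact gp_equivb_refl : reflexive gp_equivb.
Proof. by move=> s; apply/asboolP; constructor. Qed.

Fact gp_equivb_sym : symmetric gp_equivb.
Proof. by move=> s t; apply/asboolP/asboolP => /GpSym. Qed.

Fact gp_equivb_trans : transitive gp_equivb.
Proof.
by move=> t s u /asboolP st /asboolP tu; apply/asboolP; apply: GpTrans st tu.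
Qed.

Canonical gp_equiv_rel :=
  EquivRel gp_equivb gp_equivb_refl gp_equivb_sym gp_equivb_trans.

Definition graph_product := {eq_quot gp_equivb}.

HB.instance Definition _ := Choice.on graph_product.

Definition gp_class (s : seq syllable) : graph_product :=
  (\pi_({eq_quot gp_equivb}) s)%qT.
Definition gp_repr (x : graph_product) : seq syllable :=
  repr (x : {eq_quot gp_equivb}).

Lemma gp_classP s t : gp_class s = gp_class t <-> gp_equiv s t.
Proof.
split=> [st | st]; last by apply/(@eqquotP _ gp_equiv_rel)/asboolP.
by move/(@eqquotP _ gp_equiv_rel): st => /asboolP.
Qed.

Lemma gp_reprK x : gp_class (gp_repr x) = x.
Proof. exact: reprK. Qed.

Lemma gp_equiv_cat s s' t t' :
  gp_equiv s s' -> gp_equiv t t' -> gp_equiv (s ++ t) (s' ++ t').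
Proof.
move=> ss' tt'; apply: (@GpTrans _ (s' ++ t)).
  elim: ss' => [p q a b ab|a|a b _ ab|a b c _ ab _ bc].
  - by rewrite -!catA; apply: GpRel.
  - exact: GpRefl.
  - exact: GpSym.
  - exact: GpTrans ab bc.
elim: tt' => [p q a b ab|a|a b _ ab|a b c _ ab _ bc].
- by rewrite !(catA s' p); apply: GpRel.
- exact: GpRefl.
- exact: GpSym.
- exact: GpTrans ab bc.
Qed.

Definition syl_inv (x : syllable) : syllable := syl (tagged x)^-1.

Definition seq_inv (s : seq syllable) := rev (map syl_inv s).

Lemma gp_equiv_mulg v (g h : G v) :
  g * h = 1 -> gp_equiv [:: syl g; syl h] [::].
Proof.
move=> gh1; apply: (@GpTrans _ [:: syl (g * h)]).
  exact: (GpRel [::] [::] (GpMul g h)).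
by rewrite gh1; exact: (GpRel [::] [::] (GpOne v)).
Qed.

Lemma gp_equiv_invl s : gp_equiv (seq_inv s ++ s) [::].
Proof.
elim: s => [|[v g] s IHs]; first exact: GpRefl.
rewrite /seq_inv /= rev_cons -cats1 -catA /=.
apply: GpTrans IHs; apply: gp_equiv_cat; first exact: GpRefl.
rewrite -[_ :: _]/([:: syl_inv (syl g); syl g] ++ s) -[s in gp_equiv _ s]cat0s.
by apply: gp_equiv_cat; [exact/gp_equiv_mulg/mulVg | exact: GpRefl].
Qed.

Lemma gp_equiv_invr s : gp_equiv (s ++ seq_inv s) [::].
Proof.
suff invK : seq_inv (seq_inv s) = s by rewrite -{1}invK; exact: gp_equiv_invl.
rewrite /seq_inv map_rev revK -map_comp map_id_in // => -[v g] _ /=.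
by rewrite /syl_inv /= invgK.
Qed.

Definition gp_one : graph_product := gp_class [::].
Definition gp_mul (x y : graph_product) : graph_product :=
  gp_class (gp_repr x ++ gp_repr y).
Definition gp_inv (x : graph_product) : graph_product :=
  gp_class (seq_inv (gp_repr x)).

Lemma gp_class_cat s t : gp_class (s ++ t) = gp_mul (gp_class s) (gp_class t).
Proof. by apply/gp_classP/gp_equiv_cat; apply/gp_classP; rewrite gp_reprK. Qed.

Fact gp_mulA : associative gp_mul.
Proof.
move=> x y z; rewrite -(gp_reprK x) -(gp_reprK y) -(gp_reprK z).
by rewrite -!gp_class_cat catA.
Qed.

Fact gp_mul1 : left_id gp_one gp_mul.
Proof. by move=> x; rewrite -(gp_reprK x) -gp_class_cat. Qed.

Fact gp_mulr1 : right_id gp_one gp_mul.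
Proof. by move=> x; rewrite -(gp_reprK x) -gp_class_cat cats0. Qed.

Fact gp_mulV : left_inverse gp_one gp_inv gp_mul.
Proof.
move=> x; rewrite -{2}(gp_reprK x) -gp_class_cat.
exact/gp_classP/gp_equiv_invl.
Qed.

Fact gp_mulrV : right_inverse gp_one gp_inv gp_mul.
Proof.
move=> x; rewrite -{1}(gp_reprK x) -gp_class_cat.
exact/gp_classP/gp_equiv_invr.
Qed.

HB.instance Definition _ :=
  isGroup.Build graph_product gp_mulA gp_mul1 gp_mulr1 gp_mulV gp_mulrV.

Definition gp_inj (v : V) (g : G v) : graph_product := gp_class [:: syl g].

End GraphProduct.

Section Languages.

(* The least element of P (0 if P is empty). *)
Definition least (P : set nat) : nat :=
  if pselect (exists n, `[< P n >]) is left exP then ex_minn exP else 0.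

Variables (G : groupType) (X : {fset G}).

(* Words over X are sequences of elements of X seen as a finType. *)
Definition word_value (w : seq X) : G := \prod_(x <- w) val x.

Definition inverse_closed := forall x, x \in X -> x^-1 \in X.

(* For an inverse-closed X, no inverses are needed in the products. *)
Definition generating := forall g : G, exists w : seq X, word_value w = g.

Definition word_length (g : G) : nat :=
  least [set size w | w in [set w | word_value w = g]].

Definition conj_length (g : G) : nat :=
  least [set word_length (conjg g a) | a in [set: G]].

Definition geodesic_language : set (seq X) :=
  [set w | size w = word_length (word_value w)].

Definition geodesic_conjugacy_language : set (seq X) :=
  [set w | size w = conj_length (word_value w)].

End Languages.

Arguments geodesic_language {G} X.
Arguments geodesic_conjugacy_language {G} X.

Record dfa (A : finType) := Dfa {
  dfa_state : finType;
  dfa_start : dfa_state;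
  dfa_final : {set dfa_state};
  dfa_trans : dfa_state -> A -> dfa_state
}.

Definition dfa_accept (A : finType) (M : dfa A) (w : seq A) : bool :=
  foldl (@dfa_trans A M) (dfa_start M) w \in dfa_final M.

Definition regular (A : finType) (L : set (seq A)) :=
  exists M : dfa A, L = [set w | dfa_accept M w].

Definition gp_generators (V : finType) (e : rel V) (G : V -> groupType)
    (X : forall v, {fset G v}) : {fset graph_product e G} :=
  (\bigcup_(v in V) [fset gp_inj e x | x in X v])%fset.

(* Main.v *)
Require Import Defs.
From mathcomp Require Import all_boot finmap boolp classical_sets.

(** Delete from a word [w] the letters at vertices adjacent to [v] and cut what
    remains at the letters that are not at [v].  The word is geodesic if and
    only if for every [v] all blocks so obtained are geodesic in [G v], because
    the reduced form of a product of syllables, computed by letting syllables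
    act on piles of syllables, is unique up to commutation.

    For conjugacy geodesics the blocks are taken cyclically, except that a
    block commuting with all the rest of [w] has to be a conjugacy geodesic.
    Necessity follows by rotating [w].  For sufficiency, retract onto the vertex
    groups of the commuting blocks and onto the subgroup of the remaining
    vertices [R]; the part [w_R] of [w] on [R] has geodesic powers, so its length
    is the translation length of its value, which is a conjugacy invariant. *)

Set Implicit Arguments.
Unset Strict Implicit.
Unset Printing Implicit Defensive.

Local Open Scope classical_set_scope.

(** * Finite automata *)

Section Automata.

Variable A : finType.
Implicit Types (w : seq A) (L : set (seq A)).

(** Half of the Myhill-Nerode theorem: the values of [h] serve as states. *)
Lemma regular_of_invariant (Q : finType) (h : seq A -> Q) L :
    (forall u v a, h u = h v -> h (rcons u a) = h (rcons v a)) ->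
    (forall u v, h u = h v -> L u -> L v) ->
  regular L.
Proof.
move=> hS hL.
(* The transition out of [q] is computed on an arbitrary word of value [q]; by [hS] the choice does
   not matter. States outside the image of [h] are never reached and stay put. *)
pose step q a :=
  if pselect (exists u, h u = q) is left ex then h (rcons (projT1 (cid ex)) a)
  else q.
have stepE u a : step (h u) a = h (rcons u a).
  rewrite /step; case: pselect => [ex|[]]; last by exists u.
  by case: (cid ex) => v /= /(hS v u a).
pose F := [set q | `[< exists2 u, L u & h u = q >]]%SET.
exists (Dfa (h [::]) F step); apply/seteqP.
have runE w : foldl step (h [::]) w = h w.
  by elim/last_ind: w => // w a IHw; rewrite foldl_rcons IHw stepE.
split=> w /=; rewrite /dfa_accept /= runE inE.
  by move=> Lw; apply/asboolP; exists w.
by case/asboolP => u Lu huw; apply: hL huw Lu.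
Qed.

Lemma regular_invariant L : regular L ->
  exists (Q : finType) (h : seq A -> Q),
    (forall u v w, h u = h v -> h (u ++ w) = h (v ++ w)) /\
    (forall u v, h u = h v -> L u -> L v).
Proof.
case=> M ->; exists (dfa_state M), (foldl (@dfa_trans A M) (dfa_start M)).
by split=> [u v w | u v] /=; rewrite ?foldl_cat /dfa_accept => ->.
Qed.

Lemma regular_bigcap (I : finType) (L : I -> set (seq A)) :
  (forall i, regular (L i)) -> regular [set w | forall i, L i w].
Proof.
move=> regL; have /choice[M LM] i : exists M : dfa A, L i = [set w | dfa_accept M w].
  exact: regL.
pose run i := foldl (@dfa_trans A (M i)) (dfa_start (M i)).
(* Product automaton. Tagging puts the states of all [M i] in one type, so that a non-dependent
   finite function can hold them. *)
pose h w := [ffun i : I => Tagged (fun i => dfa_state (M i)) (run i w)].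
have hE u v : h u = h v <-> forall i, run i u = run i v.
  split=> [/ffunP huv i | runE]; last by apply/ffunP => i; rewrite !ffunE runE.
  have := huv i; rewrite !ffunE => /eqP; rewrite -tag_eqE /tag_eq eqxx /=.
  by rewrite tagged_asE => /eqP.
apply: (@regular_of_invariant _ h) => [u v a /hE uv | u v /hE uv Lu i].
  by apply/hE => i; rewrite /run !foldl_rcons; congr dfa_trans; apply: uv.
by have := Lu i; rewrite LM /= /dfa_accept -!/(run i _) uv.
Qed.

Definition wpow w n : seq A := flatten (nseq n w).

(* The state transformation of a word determines those of all its powers. *)
Lemma regular_wpow L : regular L -> regular [set w | forall n, L (wpow w n)].
Proof.
case=> M ->; pose h w := [ffun q => foldl (@dfa_trans A M) q w].
have hE u v : h u = h v -> forall q,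
    foldl (@dfa_trans A M) q u = foldl (@dfa_trans A M) q v.
  by move=> /ffunP uv q; have := uv q; rewrite !ffunE.
apply: (@regular_of_invariant _ h) => [u v a uv | u v uv Lu n].
  by apply/ffunP => q; rewrite !ffunE !foldl_rcons (hE _ _ uv).
have := Lu n; rewrite /= /dfa_accept /wpow.
suff -> q : foldl (@dfa_trans A M) q (flatten (nseq n u)) =
            foldl (@dfa_trans A M) q (flatten (nseq n v)) by [].
by elim: n q => //= n IHn q; rewrite !foldl_cat (hE _ _ uv).
Qed.

End Automata.

Lemma regular_pmap (A B : finType) (f : B -> option A) (L : set (seq A)) :
  regular L -> regular [set w | L (pmap f w)].
Proof.
case/regular_invariant => Q [h [hM hL]].
apply: (@regular_of_invariant _ _ (fun w => h (pmap f w))) => [u v a uv | u v uv].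
  by rewrite -!cats1 !pmap_cat; apply: hM.
exact: hL.
Qed.

Section Factors.

Variable A : finType.
Implicit Types (b : seq A) (c p q : seq (option A)).

(** [None] acts as a separator. All [None]-free factors are tested, not only the maximal ones; for
    geodesic languages, which are closed under factors, this amounts to the same. *)
Definition factors_in (L : set (seq A)) c :=
  forall p b q, c = p ++ map Some b ++ q -> L b.

Definition cond_lang (L1 : set (seq A)) (L2 : set (seq (option A))) :=
  [set c | if None \in c then L2 c else L1 (pmap id c)].

(** Subset construction: it suffices to remember the set of states reached on the [None]-free
    suffixes, together with one bit telling whether a bad factor has been met. *)
Lemma regular_factors (L : set (seq A)) :
  regular L -> regular (factors_in L).
Proof.
case=> M ->; set run := foldl (@dfa_trans A M) (dfa_start M).
pose suffixes c := [set q | `[< exists p b, c = p ++ map Some b /\ run b = q >]]%SET.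
pose L' := factors_in [set b | dfa_accept M b].
have L'_rcons c a : L' (rcons c a) <->
    L' c /\ suffixes (rcons c a) \subset dfa_final M.
  split=> [Lca | [Lc /fintype.subsetP Fca] p b q].
    split=> [p b q cE | ].
      by apply: (Lca p b (rcons q a)); rewrite cE !rcons_cat.
    apply/fintype.subsetP => x; rewrite inE => /asboolP[p [b [cE <-]]].
    by have := Lca p b [::]; rewrite cats0; apply.
  elim/last_ind: q => [|q a' _].
    rewrite cats0 => cE; apply: Fca; rewrite inE; apply/asboolP.
    by exists p, b.
  rewrite -!rcons_cat => /rcons_inj[cE _]; exact: Lc cE.
(* Such a suffix of [rcons c a] is empty or extends one of [c]; so the new set of states depends
   only on the old one and on [a]. *)
have suf_rcons c d a : suffixes c = suffixes d ->
    suffixes (rcons c a) \subset suffixes (rcons d a).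
  move=> cd; apply/fintype.subsetP => q; rewrite !inE => -[p [b [cE <-]]].
  elim/last_ind: b cE => [|b x _] cE.
    by exists (rcons d a), [::]; rewrite cats0.
  move: cE; rewrite map_rcons -rcons_cat => /rcons_inj[cE ->].
  have : run b \in suffixes c by rewrite inE; apply/asboolP; exists p, b.
  rewrite cd inE => /asboolP[p' [b' [dE bb']]].
  exists p', (rcons b' x); rewrite map_rcons -rcons_cat dE; split=> //.
  by rewrite /run !foldl_rcons -!/(run _) bb'.
apply: (@regular_of_invariant _ _ (fun c => (suffixes c, `[< L' c >]))).
  move=> c d a [cd Lcd_b]; have Lcd := asbool_eq_equiv Lcd_b.
  have sE : suffixes (rcons c a) = suffixes (rcons d a).
    by apply/eqP; rewrite finset.eqEsubset !suf_rcons.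
  congr pair => //; apply: asbool_equiv_eq.
  by split=> /L'_rcons[/Lcd ? sF]; apply/L'_rcons; split; rewrite -?sE // sE.
by move=> c d [_ cd]; have [] := asbool_eq_equiv cd.
Qed.

Lemma regular_cond (L1 : set (seq A)) (L2 : set (seq (option A))) :
  regular L1 -> regular L2 -> regular (cond_lang L1 L2).
Proof.
case/regular_invariant=> Q1 [h1 [hM1 hL1]] /regular_invariant[Q2 [h2 [hM2 hL2]]].
pose h c := (None \in c, h1 (pmap id c), h2 c).
apply: (@regular_of_invariant _ _ h) => [c d a [c0 c1 c2] | c d [c0 c1 c2]].
  rewrite /h -!cats1 !mem_cat c0 (hM2 _ _ _ c2) !pmap_cat.
  by rewrite (hM1 _ _ _ c1).
by rewrite /cond_lang /= c0; case: ifP => _; [apply: hL2 | apply: hL1].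
Qed.

End Factors.

(** * Word length and conjugacy length *)

Section Lengths.

Local Open Scope group_scope.

Lemma leastP (P : set nat) : (exists n, P n) ->
  P (least P) /\ forall n, P n -> least P <= n.
Proof.
move=> [n Pn]; rewrite /least; case: pselect => [ex | []]; last first.
  by exists n; apply/asboolP.
case: ex_minnP => m /asboolP Pm mP; split=> // k Pk.
by apply: mP; apply/asboolP.
Qed.

Variables (G : groupType) (X : {fset G}).
Implicit Types (u w b : seq X) (g h : G).

Lemma word_value_cat u w : word_value (u ++ w) = word_value u * word_value w.
Proof. by rewrite /word_value big_cat. Qed.

Lemma word_value_cons (x : X) w : word_value (x :: w) = val x * word_value w.
Proof. by rewrite /word_value big_cons. Qed.

Lemma word_value_nil : @word_value G X [::] = 1.
Proof. by rewrite /word_value big_nil. Qed.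

Lemma word_length_le w : word_length X (word_value w) <= size w.
Proof.
rewrite /word_length; set P := (X in least X).
have Pw : P (size w) by exists w.
by have [_] := leastP (ex_intro P _ Pw); apply.
Qed.

Lemma word_length_attained w :
  exists2 u : seq X, word_value u = word_value w & size u = word_length X (word_value w).
Proof.
rewrite /word_length; set P := (X in least X).
have Pw : P (size w) by exists w.
by have [[u uw <-] _] := leastP (ex_intro P _ Pw); exists u.
Qed.

Lemma word_length1 : word_length X 1 = 0.
Proof. by apply/eqP; rewrite -leqn0 -word_value_nil word_length_le. Qed.

Lemma geodesicP w : geodesic_language X w <->
  forall u, word_value u = word_value w -> size w <= size u.
Proof.
split=> [geo u uw | le_w]; first by rewrite geo -uw word_length_le.
have [u uw szu] := word_length_attained w.
by apply/eqP; rewrite /= eqn_leq word_length_le -szu le_w.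
Qed.

Hypothesis X_gen : generating X.

Lemma word_length_mul g h :
  word_length X (g * h) <= word_length X g + word_length X h.
Proof.
have [u <-] := X_gen g; have [w <-] := X_gen h.
have [u' <- <-] := word_length_attained u.
have [w' <- <-] := word_length_attained w.
by rewrite -word_value_cat -size_cat word_length_le.
Qed.

Lemma geodesic_conjugacyP w : geodesic_conjugacy_language X w <->
  forall u a, word_value u = word_value w ^ a -> size w <= size u.
Proof.
rewrite /geodesic_conjugacy_language /= /conj_length; set P := (X in least X).
have Pa a : P (word_length X (word_value w ^ a)) by exists a.
have [[b _ bP] minP] := leastP (ex_intro P _ (Pa 1)).
split=> [-> u a uw | le_w].
  by apply: leq_trans (minP _ (Pa a)) _; rewrite -uw word_length_le.
apply/eqP; rewrite eqn_leq -{1}bP; apply/andP; split.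
  (* [word_length] takes the default value 0 on elements represented by no word, so a word for the
     minimising conjugate has to be produced first. *)
  have [v vE] := X_gen (word_value w ^ b).
  have [u uv szu] := word_length_attained v.
  by rewrite vE in uv szu; rewrite -szu; apply: le_w uv.
apply: leq_trans (minP _ (Pa 1)) _.
by rewrite conjg1 word_length_le.
Qed.

Lemma geodesic_conjugacy_geodesic w :
  geodesic_conjugacy_language X w -> geodesic_language X w.
Proof.
move/geodesic_conjugacyP => wP; apply/geodesicP => u uw.
by apply: (wP _ 1); rewrite conjg1.
Qed.

End Lengths.

(** * The action of a graph product on its piles *)

Section Piles.

Local Open Scope group_scope.

Variables (V : finType) (adj : rel V).
Hypotheses (adj_sym : symmetric adj) (adj_irr : irreflexive adj).
Variable G : V -> groupType.

(* A reduced expression is encoded, up to commutation, by recording for each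
   vertex [v] the syllables at [v], with [None] standing for a syllable at some
   other vertex that is not adjacent to [v]. *)
Definition pile := forall v, seq (option (G v)).

Implicit Types (S T : pile) (u v : V).

Definition avail v S := if S v is Some _ :: _ then true else false.

Definition front v S : G v := if S v is Some g :: _ then g else 1.

(** Along with the top syllable at [v] go the markers [None] that it left on the other piles not
    adjacent to [v]. *)
Definition pop v S : pile :=
  if avail v S then fun u => if adj u v then S u else behead (S u) else S.

Definition push v (g : G v) S : pile :=
  if g == 1 then S
  else dfwith (fun u => if adj u v then S u else None :: S u) (Some g :: S v).

(** Left multiplication on reduced expressions: [x] merges with the leading syllable at its vertex,
    and the result disappears if it is trivial, since [push] ignores 1. *)
Definition act (x : syllable G) S : pile :=
  push (tagged x * front (tag x) S) (pop (tag x) S).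

Inductive reduced : pile -> Prop :=
| ReducedNil : reduced (fun _ => [::])
| ReducedPush v (g : G v) S :
    reduced S -> ~~ avail v S -> reduced (push g S).

Lemma push_in v (g : G v) S : g != 1 -> push g S v = Some g :: S v.
Proof. by rewrite /push => /negPf->; rewrite dfwith_in. Qed.

Lemma push_out v (g : G v) S u : g != 1 -> v != u ->
  push g S u = if adj u v then S u else None :: S u.
Proof. by rewrite /push => /negPf-> vu; rewrite dfwith_out. Qed.

Lemma push1 v S : push (1 : G v) S = S.
Proof. by rewrite /push eqxx. Qed.

Lemma push_adj v (g : G v) S u : adj u v -> push g S u = S u.
Proof.
move=> uv; have [->|g1] := eqVneq g 1; first by rewrite push1.
by rewrite push_out ?uv //; apply: contraTneq uv => ->; rewrite adj_irr.
Qed.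

Lemma pop_adj v S u : adj u v -> pop v S u = S u.
Proof. by rewrite /pop; case: ifP => // _ ->. Qed.

Lemma act_adj x S u : adj u (tag x) -> act x S u = S u.
Proof. by move=> ux; rewrite /act push_adj // pop_adj. Qed.

Lemma pop_unavail v S : ~~ avail v S -> pop v S = S.
Proof. by rewrite /pop => /negPf->. Qed.

Lemma front_unavail v S : ~~ avail v S -> front v S = 1.
Proof. by rewrite /avail /front; case: (S v) => [|[]]. Qed.

Lemma front_push v (g : G v) S : ~~ avail v S -> front v (push g S) = g.
Proof.
have [->|g1] := eqVneq g 1; first by rewrite push1 => /front_unavail.
by rewrite /front push_in.
Qed.

Lemma pop_push v (g : G v) S : ~~ avail v S -> pop v (push g S) = S.
Proof.
have [->|g1 _] := eqVneq g 1; first by rewrite push1 => /pop_unavail.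
rewrite /pop /avail push_in //; apply: functional_extensionality_dep => u.
have [<-|vu] := eqVneq v u; first by rewrite adj_irr push_in.
by rewrite push_out //; case: (adj u v).
Qed.

Lemma pushC u v (g : G u) (h : G v) S :
  adj u v -> push g (push h S) = push h (push g S).
Proof.
move=> uv; have vu : adj v u by rewrite adj_sym.
have [->|g1] := eqVneq g 1; first by rewrite !push1.
have [->|h1] := eqVneq h 1; first by rewrite !push1.
apply: functional_extensionality_dep => t.
have [<-|ut] := eqVneq u t; first by rewrite push_in // !(push_adj _ _ uv) push_in.
have [<-|vt] := eqVneq v t; first by rewrite (push_adj _ _ vu) !push_in // (push_adj _ _ vu).
by rewrite !push_out //; case: (adj t u); case: (adj t v).
Qed.

Lemma avail_push_adj u v (g : G v) S : adj u v -> avail u (push g S) = avail u S.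
Proof. by move=> uv; rewrite /avail push_adj. Qed.

(** The action of [G v] becomes left multiplication on [f]. By induction on the last pushed
    syllable: at [v], it is [f] itself; at a vertex adjacent to [v], it commutes with [f]; at any
    other vertex it blocks [v], and [f] is 1. *)
Lemma reduced_decomp v S : reduced S ->
  exists f : G v, exists T, [/\ reduced T, ~~ avail v T & S = push f T].
Proof.
elim=> [|u h T0 redT0 [f [T [redT vT T0E]]] uT0].
  by exists 1, (fun _ => [::]); rewrite push1; split=> //; constructor.
have [->|h1] := eqVneq h 1; first by rewrite push1; exists f, T.
have [uv|uv] := eqVneq u v; first by subst u; exists h, T0.
case vu : (adj v u); last first.
  exists 1, (push h T0); rewrite push1; split=> //; first by constructor.
  by rewrite /avail push_out // vu.
have uv' : adj u v by rewrite adj_sym.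
exists f, (push h T); split; last by rewrite T0E pushC.
  by constructor => //; rewrite -(avail_push_adj f _ uv') -T0E.
by rewrite avail_push_adj.
Qed.

Lemma act_push v (g f : G v) T :
  ~~ avail v T -> act (syl g) (push f T) = push (g * f) T.
Proof. by move=> vT; rewrite /act /= front_push // pop_push. Qed.

Lemma reduced_act x S : reduced S -> reduced (act x S).
Proof.
case: x => v g /(reduced_decomp v)[f [T [redT vT ->]]].
by rewrite act_push //; constructor.
Qed.

Lemma act1 v S : reduced S -> act (syl (1 : G v)) S = S.
Proof. by case/(reduced_decomp v) => f [T [_ vT ->]]; rewrite act_push ?mul1g. Qed.

Lemma actM v (g h : G v) S :
  reduced S -> act (syl g) (act (syl h) S) = act (syl (g * h)) S.
Proof.
case/(reduced_decomp v) => f [T [_ vT ->]].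
by rewrite !act_push // mulgA.
Qed.

Lemma actC u v (g : G u) (h : G v) S : adj u v -> reduced S ->
  act (syl g) (act (syl h) S) = act (syl h) (act (syl g) S).
Proof.
move=> uv /(reduced_decomp v)[f [S' [redS' vS' ->]]].
have vu : adj v u by rewrite adj_sym.
have [k [T [redT uT S'E]]] := reduced_decomp u redS'.
move: vS'; rewrite {}S'E avail_push_adj // => vT.
by rewrite act_push ?(pushC _ _ _ vu) ?act_push ?(pushC _ _ _ uv) ?act_push
  ?avail_push_adj.
Qed.

Definition pile_of (s : seq (syllable G)) : pile := foldr act (fun _ => [::]) s.

Lemma reduced_pile_of s : reduced (pile_of s).
Proof. by elim: s => [|x s IHs]; [constructor | apply: reduced_act]. Qed.

(** Van der Waerden's argument: the action on reduced piles satisfies the defining relations, so the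
    pile is an invariant of the group element. *)
Lemma pile_of_equiv s t : gp_equiv adj s t -> pile_of s = pile_of t.
Proof.
elim=> {s t} [p q s t st | // | // | s t u _ -> _ -> //].
rewrite /pile_of !foldr_cat; congr foldr.
have := reduced_pile_of q; rewrite /pile_of; set S := foldr _ _ q => redS.
by case: st => [v|v g h|u v g h uv]; rewrite /= ?act1 ?actM // actC.
Qed.

(** * Weight of a pile *)

Section Weight.

Variable X : forall v, {fset G v}.
Hypothesis X_gen : forall v, generating (X v).

(** The total length of the syllables of the reduced expression; separators count as 1 and have
    length 0. *)
Definition weight S : nat :=
  \sum_v \sum_(o <- S v) word_length (X v) (odflt 1%g o).

Lemma weight_push v (g : G v) S :
  weight (push g S) = word_length (X v) g + weight S.
Proof.
have [->|g1] := eqVneq g 1; first by rewrite push1 word_length1.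
rewrite /weight (bigD1 v) //= [in RHS](bigD1 v) //= push_in // big_cons addnA.
congr addn; apply: eq_bigr => u uv; rewrite push_out 1?[v == u]eq_sym //.
by case: ifP => // _; rewrite big_cons word_length1.
Qed.

Lemma weight_act v (g : G v) S : reduced S ->
  weight (act (syl g) S) <= word_length (X v) g + weight S.
Proof.
case/(reduced_decomp v) => f [T [_ vT ->]].
by rewrite act_push // !weight_push addnA leq_add2r word_length_mul.
Qed.

(** The exact change of weight, in additive form to avoid truncated subtraction. *)
Lemma weight_act_front v (g : G v) S : reduced S ->
  weight (act (syl g) S) + word_length (X v) (front v S) =
  word_length (X v) (g * front v S) + weight S.
Proof.
case/(reduced_decomp v) => f [T [_ vT ->]].
by rewrite act_push // !weight_push front_push // -!addnA [weight T + _]addnC.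
Qed.

Lemma front_act v (g : G v) S : reduced S ->
  front v (act (syl g) S) = g * front v S.
Proof.
by case/(reduced_decomp v) => f [T [_ vT ->]]; rewrite act_push // !front_push.
Qed.

Lemma front_act_adj x S u : adj u (tag x) -> front u (act x S) = front u S.
Proof. by move=> ux; rewrite /front act_adj. Qed.

Lemma front_act_nonadj u v (g : G v) S : reduced S -> g * front v S != 1 ->
  v != u -> ~~ adj u v -> front u (act (syl g) S) = 1.
Proof.
case/(reduced_decomp v) => f [T [_ vT ->]]; rewrite front_push // => gf vu uv.
by rewrite act_push // /front push_out // (negPf uv).
Qed.

End Weight.

End Piles.

(** * Factors and powers of words *)

Section SeqLemmas.

Lemma pmap_cat_inv (A B : Type) (f : A -> option B) w s t : pmap f w = s ++ t ->
  exists w1 w2, [/\ w = w1 ++ w2, pmap f w1 = s & pmap f w2 = t].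
Proof.
elim: w s => [|a w IHw] s /=.
  by case: s => //= <-; exists [::], [::].
case fa: (f a) => [b|] /=.
  case: s => [|b' s] /= => [<- | [<- /IHw[w1 [w2 [-> <- <-]]]]].
    by exists [::], (a :: w); rewrite /= fa.
  by exists (a :: w1), w2; rewrite /= fa.
case/IHw=> w1 [w2 [-> <- <-]].
by exists (a :: w1), w2; rewrite /= fa.
Qed.

Lemma map_Some_pmap (A : eqType) (c : seq (option A)) :
  None \notin c -> c = map Some (pmap id c).
Proof.
elim: c => //= -[a|] c IHc; rewrite inE //= => /IHc cE.
by rewrite {1}cE.
Qed.

Lemma pmap_Some (A : Type) (b : seq A) : pmap id (map Some b) = b.
Proof. by elim: b => //= a b ->. Qed.

Lemma wpowS (A : finType) (w : seq A) n : wpow w n.+1 = w ++ wpow w n.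
Proof. by []. Qed.

Lemma wpow_cat (A : finType) (p q : seq A) n :
  wpow (p ++ q) n.+1 = p ++ wpow (q ++ p) n ++ q.
Proof.
elim: n => [|n IHn]; first by rewrite /wpow /= cats0.
by rewrite wpowS IHn wpowS -!catA.
Qed.

Lemma pmap_wpow (A B : finType) (f : A -> option B) w n :
  pmap f (wpow w n) = wpow (pmap f w) n.
Proof. by elim: n => // n IHn; rewrite !wpowS pmap_cat IHn. Qed.

Lemma size_wpow (A : finType) (w : seq A) n : size (wpow w n) = n * size w.
Proof. by elim: n => // n IHn; rewrite wpowS size_cat IHn mulSn. Qed.

Lemma factors_in_cat (A : finType) (L : set (seq A)) p c q :
  factors_in L (p ++ c ++ q) -> factors_in L c.
Proof.
move=> Lc p' b q' cE; apply: (Lc (p ++ p') b (q' ++ q)).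
by rewrite cE -!catA.
Qed.

Lemma map_Some_prefix (A : Type) (b : seq A) q c d :
  c ++ None :: d = map Some b ++ q -> exists q', c = map Some b ++ q'.
Proof.
elim: c b => [|a c IHc] [|x b] //=; [by exists [::] | by exists (a :: c) |].
by case=> -> /IHc[q' ->]; exists q'.
Qed.

(** A [None]-free factor cannot cross the separator. *)
Lemma factors_in_None (A : finType) (L : set (seq A)) c d :
  factors_in L c -> factors_in L d -> factors_in L (c ++ None :: d).
Proof.
move=> Lc Ld p; elim: p c Lc => [|a' p IHp] c Lc b q.
  by case/map_Some_prefix=> q' cE; apply: (Lc [::] b q').
case: c Lc => [|a c] Lc /= [_]; first exact: Ld.
by apply: IHp => p' b' q' cE; apply: (Lc (a :: p') b' q'); rewrite cE.
Qed.

Lemma factors_in_wpow (A : finType) (L : set (seq A)) d n :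
  factors_in L d -> factors_in L (wpow (None :: d) n).
Proof.
move=> Ld; have dL m : factors_in L (d ++ wpow (None :: d) m).
  elim: m => [|m IHm]; first by rewrite cats0.
  by rewrite wpowS; apply: factors_in_None.
by apply: (@factors_in_cat _ _ d _ [::]); rewrite cats0.
Qed.

End SeqLemmas.

Lemma untag_Tagged (I : eqType) (T_ : I -> Type) (R : Type) (idx : R) i
  (F : T_ i -> R) (x : T_ i) : untag idx F (Tagged T_ x) = F x.
Proof. exact: (untagE idx F (erefl : tag (Tagged T_ x) = i)). Qed.

Section Powers.

Local Open Scope group_scope.

Variables (G : groupType) (X : {fset G}).
Hypothesis X_gen : generating X.

Lemma word_value_wpow (w : seq X) n : word_value (wpow w n) = word_value w ^+ n.
Proof.
elim: n => [|n IHn]; first by rewrite word_value_nil expg0.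
by rewrite wpowS word_value_cat IHn expgS.
Qed.

(* [size w] is the translation length of [word_value w], a conjugacy
   invariant: for [n] large, conjugating [u ^+ n] costs less than what is lost
   by having [size u < size w]. *)
Lemma geodesic_powers (w : seq X) :
    (forall n, geodesic_language X (wpow w n)) ->
  geodesic_conjugacy_language X w.
Proof.
move=> geo; apply/geodesic_conjugacyP => // u a uE; rewrite leqNgt; apply/negP => uw.
have [s sE] := X_gen a; have [t tE] := X_gen a^-1.
have powE n : word_value (s ++ wpow u n ++ t) = word_value (wpow w n).
  rewrite !word_value_cat !word_value_wpow uE sE tE -conjXg conjgE.
  by rewrite !mulgA mulgV mul1g mulgK.
(* Each of the [n] copies of [u] saves at least one letter, and [n] exceeds by one the cost
   [size s + size t] of conjugating. *)
have /geodesicP/(_ _ (powE _)) := geo (size s + size t).+1.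
rewrite !size_cat !size_wpow leqNgt => /negP; apply.
apply: (@leq_trans ((size s + size t).+1 * (size u).+1)).
  by rewrite [X in _ < X]mulnS addnCA addnC ltn_add2r.
by rewrite leq_mul2l uw orbT.
Qed.

End Powers.

(** * Words over the generators of a graph product *)

Section GraphProducts.

Local Open Scope group_scope.

Variables (V : finType) (adj : rel V).
Hypotheses (adj_sym : symmetric adj) (adj_irr : irreflexive adj).
Variable G : V -> groupType.

Local Notation GP := (graph_product adj G).
Local Notation inj := (gp_inj adj).

Lemma gp_injM v (g h : G v) : inj (g * h) = inj g * inj h.
Proof.
rewrite -[inj g * inj h]/(gp_mul (inj g) (inj h)) -gp_class_cat.
by apply/gp_classP/GpSym; exact: (GpRel [::] [::] (GpMul _ g h)).
Qed.

Lemma gp_inj1 v : inj (1 : G v) = 1.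
Proof.
rewrite -[RHS]/(gp_class adj [::]).
by apply/gp_classP; exact: (GpRel [::] [::] (@GpOne _ adj G v)).
Qed.

Lemma gp_injV v (g : G v) : inj g^-1 = (inj g)^-1.
Proof. by apply/eqP; rewrite -mulg_eq1 -gp_injM mulVg gp_inj1. Qed.

Lemma gp_injC u v (g : G u) (h : G v) : adj u v -> commute (inj g) (inj h).
Proof.
move=> uv; rewrite /commute -[inj g * inj h]/(gp_mul (inj g) (inj h)).
rewrite -[inj h * inj g]/(gp_mul (inj h) (inj g)) -!gp_class_cat.
by apply/gp_classP; exact: (GpRel [::] [::] (GpComm g h uv)).
Qed.

Lemma gp_class_prod (s : seq (syllable G)) :
  gp_class adj s = \prod_(x <- s) inj (tagged x).
Proof.
elim: s => [|x s IHs]; first by rewrite big_nil.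
rewrite big_cons -IHs -cat1s gp_class_cat.
by case: x => v g.
Qed.

(** * Homomorphisms out of a graph product *)

Section Lift.

Variables (H : groupType) (f : forall v, G v -> H).
Hypotheses (f1 : forall v, f (1 : G v) = 1).
Hypotheses (fM : forall v (g h : G v), f (g * h) = f g * f h).
Hypotheses (fC : forall u v (g : G u) (h : G v), adj u v -> commute (f g) (f h)).

Definition gp_lift (x : GP) : H := \prod_(s <- gp_repr x) f (tagged s).

Lemma gp_lift_class s : gp_lift (gp_class adj s) = \prod_(x <- s) f (tagged x).
Proof.
rewrite /gp_lift; have /gp_classP := gp_reprK (gp_class adj s).
move: (gp_repr _) => r; elim=> {r s} // [p q s t st | s t u _ -> _ -> //].
rewrite !big_cat /=; congr (_ * (_ * _)).
case: st => [v | v g h | u v g h uv]; rewrite !big_cons big_nil /=.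
- by rewrite f1 mulg1.
- by rewrite fM !mulg1.
- by rewrite !mulg1 fC.
Qed.

Lemma gp_liftM x y : gp_lift (x * y) = gp_lift x * gp_lift y.
Proof.
rewrite -{1}(gp_reprK x) -{1}(gp_reprK y) -[_ * _]/(gp_mul _ _) -gp_class_cat.
by rewrite gp_lift_class big_cat.
Qed.

Lemma gp_lift_inj v (g : G v) : gp_lift (inj g) = f g.
Proof. by rewrite gp_lift_class big_seq1. Qed.

Lemma gp_liftJ x y : gp_lift (x ^ y) = gp_lift x ^ gp_lift y.
Proof. by apply: (mulgI (gp_lift y)); rewrite -gp_liftM -!conjgC gp_liftM. Qed.

Lemma gp_lift_prod (I : Type) (r : seq I) (F : I -> GP) :
  gp_lift (\prod_(i <- r) F i) = \prod_(i <- r) gp_lift (F i).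
Proof.
elim: r => [|i r IHr]; last by rewrite !big_cons gp_liftM IHr.
by rewrite !big_nil -[1]/(gp_class adj [::]) gp_lift_class big_nil.
Qed.

End Lift.

(** * Generators and views of words *)

Variable X : forall v, {fset G v}.
Hypothesis X_gen : forall v, generating (X v).

Local Notation gens := (gp_generators adj X).

Lemma label_exists (y : gens) :
  exists l : {v : V & X v}, val y = inj (val (tagged l)).
Proof.
have /bigfcupP[v _ /imfsetP[x /= Xx yE]] := valP y.
by exists (Tagged (fun v => X v : Type) [` Xx]%fset).
Qed.

(** One generator may come from several vertices, as the identity can; a vertex and a preimage are
    chosen once and for all. *)
Definition label y := projT1 (cid (label_exists y)).
Definition vtx y := tag (label y).
Definition lab v y : option (X v) := untag None Some (label y).

Lemma val_label y : val y = inj (val (tagged (label y))).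
Proof. by rewrite /label; case: cid. Qed.

Lemma isSome_lab v y : isSome (lab v y) = (vtx y == v).
Proof.
rewrite /lab /vtx; have [yv|yv] := eqVneq (tag (label y)) v.
  by rewrite (untagE _ _ yv).
by rewrite untag_dflt.
Qed.

Lemma lab_vtx y : lab (vtx y) y = Some (tagged (label y)).
Proof. by rewrite /lab /vtx; case: (label y) => u z; apply: untag_Tagged. Qed.

Lemma lab_None v y : vtx y != v -> lab v y = None.
Proof. by rewrite -isSome_lab; case: (lab v y). Qed.

Lemma labP v y x : lab v y = Some x -> vtx y = v /\ val y = inj (val x).
Proof.
move=> yx; have /eqP yv : vtx y == v by rewrite -isSome_lab yx.
split=> //; move: yx; rewrite val_label /lab; move: yv; rewrite /vtx.
case: (label y) => u z; rewrite [tag _]/= => uv; subst u.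
by rewrite untag_Tagged => -[->].
Qed.

Lemma letter_subproof v (x : X v) : inj (val x) \in gens.
Proof.
apply/bigfcupP; exists v; first by rewrite mem_index_enum.
by apply/imfsetP; exists (val x) => //; apply: valP.
Qed.

Definition letter v (x : X v) : gens := [` letter_subproof x]%fset.

Lemma word_value_letters v (b : seq (X v)) :
  word_value (map (@letter v) b) = inj (word_value b).
Proof.
elim: b => [|x b IHb]; first by rewrite !word_value_nil gp_inj1.
by rewrite /= !word_value_cons IHb gp_injM.
Qed.

Lemma gens_generating : generating gens.
Proof.
move=> g; rewrite -(gp_reprK g) gp_class_prod.
elim: (gp_repr g) => [|x s [w wE]].
  by exists [::]; rewrite big_nil word_value_nil.
have [b bE] := X_gen (tagged x).
exists (map (@letter _) b ++ w).
by rewrite big_cons word_value_cat word_value_letters bE wE.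
Qed.

(* What the vertex [v] sees of a word: letters at vertices adjacent to [v] are
   erased, and those at other vertices become the separator [None]. *)
Definition view v (w : seq gens) : seq (option (X v)) :=
  pmap (fun y => if adj v (vtx y) then None else Some (lab v y)) w.

Lemma pmap_view v w : pmap id (view v w) = pmap (lab v) w.
Proof.
elim: w => //= y w IHw; case: ifP => [vy | _] /=; last by rewrite IHw.
by rewrite IHw lab_None //; apply: contraTneq vy => ->; rewrite adj_irr.
Qed.

Lemma commute_star v (g : G v) w :
  commute (inj g) (word_value [seq y <- w | adj v (vtx y)]).
Proof.
elim: w => [|y w IHw] /=; first by rewrite word_value_nil; exact: commute1.
case: ifP => // vy; rewrite word_value_cons; apply: commuteM => //.
by rewrite val_label; apply: gp_injC.
Qed.

(** Without a separator in the view, every letter is at [v] or at a vertex adjacent to [v]; the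
    latter commute to the right of the block. *)
Lemma view_block v w b : view v w = map Some b ->
  word_value w = inj (word_value b) * word_value [seq y <- w | adj v (vtx y)] /\
  size w = (size b + size [seq y <- w | adj v (vtx y)])%N.
Proof.
elim: w b => [|y w IHw] b /=.
  by case: b => // _; rewrite !word_value_nil gp_inj1 mul1g.
case: ifP => [vy /IHw[wE ->] | _ /=].
  rewrite !word_value_cons wE; split; last by rewrite addnS.
  rewrite !mulgA; congr (_ * _); rewrite val_label; apply: gp_injC.
  by rewrite adj_sym.
case: b => // x b [/labP[_ yE] /IHw[wE ->]].
by rewrite !word_value_cons wE yE gp_injM mulgA.
Qed.

(** A shorter word for a block could replace it inside [w], with the same value. *)
Lemma geodesic_view v w : geodesic_language gens w ->
  factors_in (geodesic_language (X v)) (view v w).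
Proof.
move=> /geodesicP geo p b q /pmap_cat_inv[w1 [w23 [wE _ /pmap_cat_inv[w2]]]].
case=> w3 [w23E /view_block[w2E sz_w2] _].
apply/geodesicP => b' b'E.
have /geo : word_value (w1 ++ (map (@letter v) b' ++ [seq y <- w2 | adj v (vtx y)])
    ++ w3) = word_value w.
  by rewrite wE w23E !word_value_cat word_value_letters b'E w2E.
by rewrite wE w23E !size_cat sz_w2 size_map leq_add2l leq_add2r leq_add2r.
Qed.

(** * Geodesic words and their piles *)

Definition syllables w := map (fun y => syl (val (tagged (label y)))) w.

Lemma gp_class_syllables w : gp_class adj (syllables w) = word_value w.
Proof.
rewrite gp_class_prod big_map; apply: eq_bigr => y _.
by rewrite val_label.
Qed.

Lemma weight_pile w : weight X (pile_of adj (syllables w)) <= size w.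
Proof.
elim: w => [|y w IHw] /=.
  by rewrite /weight big1 // => v _; rewrite big_nil.
apply: leq_trans (weight_act _ _ _ _ _) _ => //; first exact: reduced_pile_of.
rewrite -add1n leq_add //; have := word_length_le [:: tagged (label y)].
by rewrite word_value_cons word_value_nil mulg1.
Qed.

Definition first_block v (c : seq (option (X v))) : seq (X v) :=
  pmap id (take (find (pred1 None) c) c).

Lemma first_blockP v (c : seq (option (X v))) :
  exists q, c = map Some (first_block c) ++ q.
Proof.
elim: c => [|[x|] c [q IHc]]; first by exists [::].
  by exists q; rewrite {1}IHc.
by exists (None :: c).
Qed.

(** The two claims need each other. Prepending [y] turns the first block [b] at its vertex into
    [x :: b]; both are geodesic, so by [weight_act_front] the weight grows by exactly one. *)
Lemma geodesic_views_pile w :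
    (forall v, factors_in (geodesic_language (X v)) (view v w)) ->
  weight X (pile_of adj (syllables w)) = size w /\
  forall v, front v (pile_of adj (syllables w)) = word_value (first_block (view v w)).
Proof.
elim: w => [_ | y w IHw yw_geo] /=.
  split=> [|v]; first by rewrite /weight big1 // => v _; rewrite big_nil.
  by rewrite word_value_nil.
have [|weightE frontE] := IHw.
  move=> v; have := yw_geo v; rewrite /view /=.
  case: ifP => // _ /= geo; apply: (@factors_in_cat _ _ [:: lab v y] _ [::]).
  by rewrite cats0.
set S := pile_of _ _ in weightE frontE *.
have redS : reduced adj S by apply: reduced_pile_of.
move: (yw_geo (vtx y)); rewrite /view /= adj_irr -/(view _ _).
rewrite lab_vtx; set x := tagged (label y).
set c := view (vtx y) w; set b := first_block c => geo.
have [q cE] := first_blockP c.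
have b_geo : geodesic_language (X (vtx y)) b.
  by apply: (geo [:: Some x] b q); rewrite {1}cE.
have xb_geo : geodesic_language (X (vtx y)) (x :: b).
  by apply: (geo [::] (x :: b) q); rewrite {1}cE.
have valE : val x * front (vtx y) S = word_value (x :: b).
  by rewrite frontE word_value_cons.
(* A trivial product would vanish from the pile instead of blocking the vertices not adjacent to
   [vtx y]. *)
have val_n1 : val x * front (vtx y) S != 1.
  by apply/eqP => val1; move: xb_geo; rewrite /geodesic_language /= -valE val1 word_length1.
split=> [|u].
  have := weight_act_front adj_sym adj_irr X (val x) redS.
  rewrite valE frontE -/b weightE.
  rewrite -[word_length _ (word_value (x :: b))]xb_geo.
  rewrite -[word_length _ (word_value b)]b_geo /=.
  by rewrite addnC addSnnS => /addnI.
rewrite /view /=; case: ifP => [uy | /negbT uy].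
  by rewrite front_act_adj // frontE.
have [uv | uv] := eqVneq (vtx y) u.
  by subst u; rewrite lab_vtx front_act // frontE /first_block /= word_value_cons.
rewrite lab_None // front_act_nonadj // 1?eq_sym //.
by rewrite word_value_nil.
Qed.

(** For sufficiency: the weight depends only on the value, equals [size w], and is at most the size
    of any other word with that value. *)
Lemma geodesic_viewsP w : geodesic_language gens w <->
  forall v, factors_in (geodesic_language (X v)) (view v w).
Proof.
split=> [geo v | /geodesic_views_pile[weightE _]]; first exact: geodesic_view.
apply/geodesicP => u; rewrite -!gp_class_syllables => /gp_classP.
move/(pile_of_equiv adj_sym adj_irr) => uw.
by rewrite -weightE -uw weight_pile.
Qed.

(* When [None] occurs in [view v w], the cyclic blocks at [v] are the maximal
   [None]-free factors of its powers; otherwise [v] is joined to all other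
   vertices of [w], and its single block can be conjugated inside [G v]. *)
Definition cyclic_view v w :=
  cond_lang (geodesic_conjugacy_language (X v))
    [set c | forall n, factors_in (geodesic_language (X v)) (wpow c n)]
    (view v w).

(** * Conjugacy geodesics and cyclic views *)

Lemma geodesic_conjugacy_rot (w1 w2 : seq gens) :
  geodesic_conjugacy_language gens (w1 ++ w2) ->
  geodesic_conjugacy_language gens (w2 ++ w1).
Proof.
move=> /(geodesic_conjugacyP gens_generating) cgeo.
apply/(geodesic_conjugacyP gens_generating) => u a uE.
rewrite size_cat addnC -size_cat; apply: (cgeo _ (word_value w1 * a)).
rewrite uE !word_value_cat conjgM; congr (_ ^ _).
by rewrite conjgE !mulgA mulVg mul1g.
Qed.

Lemma geodesic_conjugacy_view w v :
  geodesic_conjugacy_language gens w -> cyclic_view v w.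
Proof.
move=> cgeo; rewrite /cyclic_view /cond_lang /=; case: ifPn => [vN n | /map_Some_pmap].
  (* Rotating [w] to start at a letter seen as [None] turns the view into [None :: c2 ++ c1], whose
     powers are cut by separators into copies of [c2 ++ c1]. *)
  case/splitPr: {2}(view v w) / vN (erefl (view v w)) => c1 c2 wE.
  have [w1 [w2 [w12 w1E w2E]]] := pmap_cat_inv wE.
  have d_geo : factors_in (geodesic_language (X v)) (c2 ++ c1).
    apply: (@factors_in_cat _ _ [:: None] _ [::]).
    rewrite cats0 -[X in factors_in _ X]/((None :: c2) ++ c1) -w1E -w2E -pmap_cat.
    apply: geodesic_view.
    apply: (geodesic_conjugacy_geodesic gens_generating).
    by apply: geodesic_conjugacy_rot; rewrite -w12.
  (* The [n]-th power of the view is a factor of the power [n.+1] of the rotated one. *)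
  apply: (@factors_in_cat _ _ (None :: c2) _ c1).
  by rewrite wE -wpow_cat; apply: factors_in_wpow.
rewrite pmap_view; set b := pmap _ w => /view_block[wE szw].
(* Conjugation by [inj a] fixes the letters adjacent to [v], so putting [b'] in place of [b]
   represents a conjugate of [w]. *)
apply/(geodesic_conjugacyP (@X_gen v)) => b' a b'E.
move: cgeo => /(geodesic_conjugacyP gens_generating).
move/(_ (map (@letter v) b' ++ [seq y <- w | adj v (vtx y)]) (inj a)).
rewrite szw size_cat size_map leq_add2r; apply.
rewrite word_value_cat word_value_letters b'E wE conjMg; congr (_ * _).
  by rewrite !conjgE !gp_injM gp_injV.
by rewrite conjgE -(commute_star a w) mulKg.
Qed.

(** * Retractions onto vertex groups and onto sets of vertices *)

Definition gp_proj v u (g : G u) : G v :=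
  @untag V (fun t => G t : Type) (G v) 1 v id (syl g).

Lemma gp_proj_in v (g : G v) : gp_proj v g = g.
Proof. exact: untag_Tagged. Qed.

Lemma gp_proj_out v u (g : G u) : u != v -> gp_proj v g = 1.
Proof. by move=> uv; rewrite /gp_proj untag_dflt. Qed.

Lemma gp_proj1 v u : gp_proj v (1 : G u) = 1.
Proof.
have [uv|/gp_proj_out //] := eqVneq u v.
by subst u; rewrite gp_proj_in.
Qed.

Lemma gp_projM v u (g h : G u) : gp_proj v (g * h) = gp_proj v g * gp_proj v h.
Proof.
have [uv|uv] := eqVneq u v; last by rewrite !gp_proj_out ?mulg1.
by subst u; rewrite !gp_proj_in.
Qed.

(** Adjacent vertices are distinct, so at least one of the two projections is 1. *)
Lemma gp_projC v u t (g : G u) (h : G t) :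
  adj u t -> commute (gp_proj v g) (gp_proj v h).
Proof.
move=> ut; have [uv|uv] := eqVneq u v; last first.
  by rewrite [gp_proj v g]gp_proj_out //; apply/commute_sym/commute1.
rewrite [gp_proj v h]gp_proj_out; first exact: commute1.
by apply: contraTneq ut => ->; rewrite uv adj_irr.
Qed.

Lemma gp_proj_word v w :
  gp_lift (gp_proj v) (word_value w) = word_value (pmap (lab v) w).
Proof.
have [[p1 pM] pC] := (gp_proj1 v, @gp_projM v, @gp_projC v).
rewrite /word_value gp_lift_prod //.
elim: w => [|y w IHw]; first by rewrite !big_nil.
rewrite big_cons IHw val_label gp_lift_inj //=.
have [yv|yv] := eqVneq (vtx y) v.
  by subst v; rewrite lab_vtx /= big_cons gp_proj_in.
by rewrite lab_None //= gp_proj_out // mul1g.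
Qed.

Definition gp_restr (R : {set V}) u (g : G u) : GP := if u \in R then inj g else 1.

Lemma gp_restr1 R u : gp_restr R (1 : G u) = 1.
Proof. by rewrite /gp_restr gp_inj1 if_same. Qed.

Lemma gp_restrM R u (g h : G u) :
  gp_restr R (g * h) = gp_restr R g * gp_restr R h.
Proof. by rewrite /gp_restr; case: ifP => _; rewrite ?mulg1 ?gp_injM. Qed.

Lemma gp_restrC R u t (g : G u) (h : G t) :
  adj u t -> commute (gp_restr R g) (gp_restr R h).
Proof.
rewrite /gp_restr => ut; case: ifP => _; last by apply/commute_sym/commute1.
by case: ifP => _; [apply: gp_injC | apply: commute1].
Qed.

Lemma gp_restr_word (R : {set V}) w :
  gp_lift (gp_restr R) (word_value w) = word_value [seq y <- w | vtx y \in R].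
Proof.
have [[r1 rM] rC] := (gp_restr1 R, @gp_restrM R, @gp_restrC R).
rewrite /word_value gp_lift_prod // big_filter [RHS]big_mkcond /=.
by apply: eq_bigr => y _; rewrite [in LHS]val_label gp_lift_inj // /gp_restr val_label.
Qed.

(** Every letter has exactly one vertex; this lets two words be compared retraction by
    retraction. *)
Lemma size_split (I : {set V}) w :
  size w = (\sum_(v in I) size (pmap (lab v) w)
            + size [seq y <- w | vtx y \in ~: I])%N.
Proof.
elim: w => [|y w IHw] /=; first by rewrite big1.
have -> : (\sum_(v in I) size (oapp (cons^~ (pmap (lab v) w)) (pmap (lab v) w) (lab v y))
    = (vtx y \in I) + \sum_(v in I) size (pmap (lab v) w))%N.
  rewrite (eq_bigr (fun v => isSome (lab v y) + size (pmap (lab v) w))%N); last first.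
    by move=> v _; case: (lab v y).
  rewrite big_split /=; congr addn; rewrite big_mkcond (bigD1 (vtx y)) //= big1.
    by rewrite isSome_lab eqxx addn0; case: ifP.
  by move=> v /negPf vy; rewrite isSome_lab eq_sym vy if_same.
by rewrite inE IHw; case: (vtx y \in I) ; rewrite /= ?addSn ?addnS.
Qed.

Lemma cyclic_views_geodesic_conjugacy w :
  (forall v, cyclic_view v w) -> geodesic_conjugacy_language gens w.
Proof.
(* [I] consists of the vertices adjacent to every vertex of [w] other than themselves; the
   complement of [I] plays the part of [R]. *)
move=> cyc; pose I := [set v | None \notin view v w]%SET.
pose wR u := [seq y <- u | vtx y \in ~: I].
have R_geo : geodesic_conjugacy_language gens (wR w).
  apply: (geodesic_powers gens_generating) => n; apply/geodesic_viewsP => v.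
  rewrite /view pmap_wpow -/(view v _).
  have [/hasP[y] | /hasPn noR] := boolP (has (fun y => vtx y == v) (wR w)).
    rewrite mem_filter !inE negbK => /andP[yR yw] /eqP yv.
    (* The removed letters are at vertices of [I]; as [y] occurs at [v], which is not in [I], these
       vertices are adjacent to [v], and [v] does not see them. *)
    have -> : view v (wR w) = view v w.
      (* The induction runs over a list of letters of [w], while [I] keeps referring to all of
         [w]. *)
      have : {subset w <= w} by [].
      rewrite /view /wR; elim: {1 3 4}w => //= z s IHs zs_w.
      have {}/IHs IHs : {subset s <= w}.
        by move=> t ts; apply: zs_w; rewrite inE ts orbT.
      have zw : z \in w by apply: zs_w; rewrite mem_head.
      case: ifPn => /= [_ | ]; first by rewrite IHs.
      rewrite !inE negbK IHs => zI; case: ifPn => //= vz; case/negP: (zI).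
      rewrite mem_pmap; apply/mapP; exists y => //.
      rewrite yv adj_sym (negPf vz) lab_None // yv.
      by apply: contraTneq yR => vz'; rewrite yv vz'.
    by have := cyc v; rewrite /cyclic_view /cond_lang /= -yv yR; apply.
  (* Here [wR w] has no letter at [v], so only empty blocks occur. *)
  have wR0 : pmap (lab v) (wR w) = [::].
    elim: (wR w) noR => //= y s IHs noR.
    rewrite lab_None ?IHs //; last by apply: noR; rewrite mem_head.
    by move=> z zs; apply: noR; rewrite inE zs orbT.
  move=> p b q /(congr1 (pmap id)).
  rewrite pmap_wpow pmap_view wR0 !pmap_cat pmap_Some => /esym bE.
  have -> : b = [::].
    apply/nilP; have := congr1 size bE; rewrite !size_cat size_wpow muln0.
    by move/eqP; rewrite !addn_eq0 => /and3P[].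
  by rewrite /geodesic_language /= word_value_nil word_length1.
apply/(geodesic_conjugacyP gens_generating) => u a uE.
(* Each retraction sends the values of [u] and [w] to conjugate elements, and the corresponding part
   of [w] is a conjugacy geodesic. *)
rewrite (size_split I w) (size_split I u) leq_add //.
  apply: leq_sum => v; rewrite inE => vI.
  have := cyc v; rewrite /cyclic_view /cond_lang /= (negPf vI) pmap_view.
  move=> /(geodesic_conjugacyP (@X_gen v)); apply; rewrite -!gp_proj_word uE.
  exact: gp_liftJ (gp_proj1 v) (@gp_projM v) (@gp_projC v) _ _.
move/(geodesic_conjugacyP gens_generating): R_geo; apply.
rewrite -!gp_restr_word uE.
exact: gp_liftJ (gp_restr1 _) (@gp_restrM _) (@gp_restrC _) _ _.
Qed.

End GraphProducts.

Theorem theorem3p1 (V : finType) (adj : rel V)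
    (adj_sym : symmetric adj) (adj_irr : irreflexive adj)
    (G : V -> groupType) (X : forall v : V, {fset G v})
    (X_inv : forall v : V, inverse_closed (X v))
    (X_gen : forall v : V, generating (X v))
    (X_geo : forall v : V, regular (geodesic_language (X v)))
    (X_conj : forall v : V, regular (geodesic_conjugacy_language (X v))) :
  regular (geodesic_language (gp_generators adj X)) /\
  regular (geodesic_conjugacy_language (gp_generators adj X)).
Proof.
split.
  have -> : geodesic_language (gp_generators adj X) = [set w | forall v,
      factors_in (geodesic_language (X v)) (view v w)].
    by apply/seteqP; split=> w /(geodesic_viewsP adj_sym adj_irr X_gen).
  apply: regular_bigcap => v; apply: regular_pmap.
  exact: regular_factors.
have -> : geodesic_conjugacy_language (gp_generators adj X) =
    [set w | forall v, cyclic_view v w].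
  apply/seteqP; split=> w; last exact: cyclic_views_geodesic_conjugacy.
  by move=> cgeo v; apply: geodesic_conjugacy_view.
apply: regular_bigcap => v; apply: regular_pmap.
apply: regular_cond => //; apply: regular_wpow; exact: regular_factors.
Qed.
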